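(* Let $\alpha$ be a countable ordinal. (1) If $\alpha=m$ is finite with $m\ge1$, then $\mathsf{rk}(\mathbb Z\cdot m)=\omega+\lfloor\log_2(m+1)\rfloor$. (2) If $\alpha\ge\omega$ and the leading term of the Cantor normal form of $\alpha$ is $\omega^{\beta_1}\cdot c_1$ (so $\beta_1\ge1$, $1\le c_1<\omega$), then $\mathsf{rk}(\mathbb Z\cdot\alpha)=\omega\cdot(1+\beta_1)+\lfloor\log_2 c_1\rfloor$, where $1+\beta_1$ is ordinal addition with $1$ on the left. In particular, for $\alpha\ge\omega$ the rank depends only on the leading term of the Cantor normal form.
   Context: For an ordinal $\alpha$, $\mathbb Z\cdot\alpha$ denotes the linear order consisting of $\alpha$ consecutive copies of $(\mathbb Z,<)$: the lexicographic order on $\alpha\times\mathbb Z$ comparing first the $\alpha$-coordinate. Let $\mathcal F$ be the class of finite linear orders (language $\{<\}$); countable linear orders are the structures considered; substructures are suborders and $\mathsf{age}(X)$ is the set of finite suborders of $X$. For $A\le B$, $B$ is a prime extension of $A$ if $|B\setminus A|=1$; a realization of $B$ in $X$ (where $A\le X$) is $C\le X$ with $A\le C$ and an order-isomorphism $B\to C$ fixing $A$ pointwise. For $F\in\mathsf{age}(X)$ define by recursion: $\mathsf{rk}_X(F)\ge0$ always; $\mathsf{rk}_X(F)\ge\gamma+1$ iff every prime extension $B\in\mathcal F$ of $F$ has a realization $C$ in $X$ with $\mathsf{rk}_X(C)\ge\gamma$; for limit $\gamma$, $\mathsf{rk}_X(F)\ge\gamma$ iff $\mathsf{rk}_X(F)\ge\delta$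 for all $\delta<\gamma$. $\mathsf{rk}_X(F)=\sup\{\gamma:\mathsf{rk}_X(F)\ge\gamma\}$ (or $\infty$ if this holds for all ordinals), and $\mathsf{rk}(X)=\mathsf{rk}_X(\emptyset)$. *)

(* Defs.v *)
(* Countable ordinals are represented by Brouwer trees. *)
From Stdlib Require Import ZArith List PeanoNat.
Import ListNotations.

Inductive Ord : Type :=
| OZ : Ord
| OS : Ord -> Ord
| OL : (nat -> Ord) -> Ord.          (* supremum of a sequence *)

Fixpoint ole (a b : Ord) {struct a} : Prop :=
  match a with
  | OZ => True
  | OS a' =>
      (fix lt_b (b : Ord) : Prop :=
         match b with
         | OZ => False
         | OS b' => ole a' b'
         | OL g => exists n, lt_b (g n)
         end) b
  | OL f => forall n, ole (f n) b
  end.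

Definition olt (a b : Ord) : Prop := ole (OS a) b.

Definition oeq (a b : Ord) : Prop := ole a b /\ ole b a.

Fixpoint ofnat (n : nat) : Ord :=
  match n with
  | O => OZ
  | S k => OS (ofnat k)
  end.

Definition omega : Ord := OL ofnat.

Fixpoint oadd (a b : Ord) : Ord :=
  match b with
  | OZ => a
  | OS b' => OS (oadd a b')
  | OL f => OL (fun n => oadd a (f n))
  end.

Fixpoint omul (a b : Ord) : Ord :=
  match b with
  | OZ => OZ
  | OS b' => oadd (omul a b') a
  | OL f => OL (fun n => omul a (f n))
  end.

Fixpoint oexp (b : Ord) : Ord :=
  match b with
  | OZ => OS OZ
  | OS b' => omul (oexp b') omega
  | OL f => OL (fun n => oexp (f n))
  end.

Definition is_limit (g : Ord) : Prop :=
  ~ oeq g OZ /\ ~ (exists d, oeq g (OS d)).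

Fixpoint cnf_sum (l : list (Ord * nat)) : Ord :=
  match l with
  | [] => OZ
  | (b, c) :: l' => oadd (omul (oexp b) (ofnat c)) (cnf_sum l')
  end.

Fixpoint cnf_wf (l : list (Ord * nat)) : Prop :=
  match l with
  | [] => True
  | (b, c) :: l' =>
      (1 <= c)%nat /\
      (match l' with [] => True | (b', _) :: _ => olt b' b end) /\
      cnf_wf l'
  end.

Definition is_CNF (alpha : Ord) (l : list (Ord * nat)) : Prop :=
  cnf_wf l /\ oeq alpha (cnf_sum l).

Definition Ocls : Type := { P : Ord -> Prop | exists a, P = oeq a }.

Definition cls_lt (p q : Ocls) : Prop :=
  exists a b, proj1_sig p a /\ proj1_sig q b /\ olt a b.

Definition OrdBelow (alpha : Ord) : Type :=
  { p : Ocls | exists a, proj1_sig p a /\ olt a alpha }.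

Definition ZdotCar (alpha : Ord) : Type := (OrdBelow alpha * Z)%type.

Definition ZdotLt (alpha : Ord) (x y : ZdotCar alpha) : Prop :=
  cls_lt (proj1_sig (fst x)) (proj1_sig (fst y))
  \/ (fst x = fst y /\ (snd x < snd y)%Z).

Definition strict_linear {T : Type} (R : T -> T -> Prop) : Prop :=
  (forall u, ~ R u u) /\
  (forall u v w, R u v -> R v w -> R u w) /\
  (forall u v, u <> v -> R u v \/ R v u).

Section Rank.
Variables (X : Type) (lt : X -> X -> Prop).

(* a finite suborder A of X is given by a finite list of its elements *)
Definition elts (A : list X) : Type := { x : X | In x A }.

(* carrier of a one-point extension B of A: A plus one new point (None) *)
Definition pext (A : list X) : Type := option (elts A).

Definition is_prime_ext (A : list X) (R : pext A -> pext A -> Prop) : Prop :=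
  strict_linear R /\
  (forall a b : elts A,
      R (Some a) (Some b) <-> lt (proj1_sig a) (proj1_sig b)).

Definition realizes (A : list X) (R : pext A -> pext A -> Prop) (C : list X)
  : Prop :=
  incl A C /\
  exists f : pext A -> X,
    (forall u, In (f u) C) /\
    (forall c, In c C -> exists u, f u = c) /\
    (forall u v, f u = f v -> u = v) /\
    (forall u v, R u v <-> lt (f u) (f v)) /\
    (forall a : elts A, f (Some a) = proj1_sig a).

Inductive rk_ge : list X -> Ord -> Prop :=
| rk_ge_zero (F : list X) (g : Ord) :
    oeq g OZ -> rk_ge F g
| rk_ge_succ (F : list X) (g d : Ord) :
    oeq g (OS d) ->
    (forall R, is_prime_ext F R -> exists C, realizes F R C /\ rk_ge C d) ->
    rk_ge F g
| rk_ge_lim (F : list X) (g : Ord) :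
    is_limit g ->
    (forall d, olt d g -> rk_ge F d) ->
    rk_ge F g.

Definition rk_is (F : list X) (g : Ord) : Prop :=
  (forall d, rk_ge F d -> ole d g) /\
  (forall e, (forall d, rk_ge F d -> ole d e) -> ole g e).

Definition rank_is (g : Ord) : Prop := rk_is [] g.

End Rank.

(* Main.v *)
(** The rank of a finite suborder is governed by its gaps separately: an open
    interval has rank [>= g + 1] iff it contains a point both of whose sides have
    rank [>= g].  For Z·alpha give the end points of intervals the positions
    [pos (xi, z) = 1 + xi], [pos -oo = 0], [pos +oo = 1 + alpha].  An interval
    inside one copy of Z, with end points at distance [k], has rank
    [floor (log2 k)]; any other interval [(a, b)] has rank
    [>= omega (1 + beta) + n] as soon as [pos a + omega^beta 2^n <= pos b], and
    rank [<= omega (1 + beta) + n] as soon as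
    [pos b < pos a + omega^beta 2^(n+1)].  Both bounds are preserved by splitting
    at a point: halve [2^n] when [n > 0], and otherwise drop to a smaller exponent,
    using [omega^beta' k + omega^beta = omega^beta] for [beta' < beta].  Since
    [1 + alpha = alpha] for infinite [alpha], finite and infinite [alpha] are
    covered by the same statement for the interval [(-oo, +oo)]. *)
Require Import Defs.
From Stdlib Require Import ZArith List PeanoNat Lia.
From Stdlib Require Import Classical ClassicalEpsilon FunctionalExtensionality
  PropExtensionality ProofIrrelevance.
Import ListNotations.

(** * Countable ordinals as Brouwer trees *)

Lemma ole_sup (a : Ord) (f : nat -> Ord) (n : nat) : ole a (f n) -> ole a (OL f).
Proof.
  induction a as [|a IH|g IH]; intros H; simpl in *; [exact I| |].
  - now exists n.
  - intros k. apply IH, H.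
Qed.

Lemma ole_succ_r (a b : Ord) : ole a b -> ole a (OS b).
Proof.
  revert b; induction a as [|a IH|g IH]; intros b H; [exact I| |].
  - simpl. induction b as [|b IHb|f IHb].
    + destruct H.
    + apply IH, H.
    + destruct H as [n Hn]. apply ole_sup with n, IHb, Hn.
  - intros n. apply IH, H.
Qed.

Lemma ole_refl (a : Ord) : ole a a.
Proof.
  induction a as [|a IH|f IH]; [exact I|exact IH|].
  intros n. apply ole_sup with n, IH.
Qed.

Lemma ole_trans (a b c : Ord) : ole a b -> ole b c -> ole a c.
Proof.
  revert b c; induction a as [|a IH|f IH]; intros b c Hab Hbc; [exact I| |].
  - induction b as [|b _|g IHb]; [destruct Hab| |].
    + induction c as [|c _|h IHc]; [destruct Hbc| |].
      * exact (IH b c Hab Hbc).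
      * destruct Hbc as [n Hn]. exists n. exact (IHc n Hn).
    + destruct Hab as [n Hn]. exact (IHb n Hn (Hbc n)).
  - intros n. exact (IH n b c (Hab n) Hbc).
Qed.

Lemma olt_ole (a b : Ord) : olt a b -> ole a b.
Proof. apply ole_trans, ole_succ_r, ole_refl. Qed.

Lemma olt_succ_diag (a : Ord) : olt a (OS a).
Proof. exact (ole_refl (OS a)). Qed.

Lemma olt_ole_trans (a b c : Ord) : olt a b -> ole b c -> olt a c.
Proof. exact (ole_trans (OS a) b c). Qed.

Lemma ole_olt_trans (a b c : Ord) : ole a b -> olt b c -> olt a c.
Proof. intros Hab. exact (ole_trans (OS a) (OS b) c Hab). Qed.

Lemma olt_trans (a b c : Ord) : olt a b -> olt b c -> olt a c.
Proof. intros H1 H2. exact (olt_ole_trans _ _ _ H1 (olt_ole _ _ H2)). Qed.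

(** Classical: at a limit, either the bound dominates every term or some term escapes it, and that
    term settles the comparison. *)
Lemma ole_or_olt (a b : Ord) : ole a b \/ olt b a.
Proof.
  revert b; induction a as [|a IH|f IH]; intros b; [left; exact I| |].
  - induction b as [|b _|g IHb].
    + right; exact I.
    + exact (IH b).
    + destruct (classic (forall n, ole (g n) a)) as [H|H]; [now right|].
      apply not_all_ex_not in H as [n Hn].
      destruct (IHb n) as [H|H]; [|contradiction].
      left. now exists n.
  - destruct (classic (forall n, ole (f n) b)) as [H|H]; [now left|].
    apply not_all_ex_not in H as [n Hn].
    destruct (IH n b) as [H|H]; [contradiction|].
    right. now exists n.
Qed.

(** Induction on a tree [b], treating all [a] with [ole a b] at once: a tree strictly below [OL f]
    is already strictly below some [f n]. *)
Lemma olt_wf : well_founded olt.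
Proof.
  assert (forall b a, ole a b -> Acc olt a) as H.
  { induction b as [|b IH|f IH]; intros a Ha; constructor; intros c Hc;
      pose proof (olt_ole_trans _ _ _ Hc Ha) as Hcb.
    - destruct Hcb.
    - apply IH, Hcb.
    - destruct Hcb as [n Hn]. apply (IH n (OS c)); [exact Hn|apply olt_succ_diag]. }
  intros a. apply (H a), ole_refl.
Qed.

Lemma olt_irrefl (a : Ord) : ~ olt a a.
Proof.
  induction (olt_wf a) as [a _ IH]. intros H. exact (IH a H H).
Qed.

Lemma ole_not_olt (a b : Ord) : ole a b -> ~ olt b a.
Proof. intros H1 H2. exact (olt_irrefl b (olt_ole_trans _ _ _ H2 H1)). Qed.

Lemma not_ole_olt (a b : Ord) : ~ ole a b -> olt b a.
Proof. intros H. destruct (ole_or_olt a b); tauto. Qed.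

(** * Ordinal addition *)

Lemma oadd_0_l (a : Ord) : oadd OZ a = a.
Proof.
  induction a as [|a IH|f IH]; simpl; [reflexivity|now rewrite IH|].
  f_equal. apply functional_extensionality, IH.
Qed.

Lemma oadd_assoc (a b c : Ord) : oadd a (oadd b c) = oadd (oadd a b) c.
Proof.
  induction c as [|c IH|f IH]; simpl; [reflexivity|now rewrite IH|].
  f_equal. apply functional_extensionality, IH.
Qed.

Lemma oadd_ge_l (a b : Ord) : ole a (oadd a b).
Proof.
  induction b as [|b IH|f IH]; simpl.
  - apply ole_refl.
  - apply ole_succ_r, IH.
  - apply ole_sup with 0, IH.
Qed.

Lemma oadd_le_r (a b c : Ord) : ole b c -> ole (oadd a b) (oadd a c).
Proof.
  revert c; induction b as [|b IH|f IH]; intros c H.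
  - apply oadd_ge_l.
  - induction c as [|c _|g IHc]; [destruct H|exact (IH c H)|].
    destruct H as [n Hn]. exists n. apply IHc, Hn.
  - intros n. apply IH, H.
Qed.

Lemma oadd_lt_r (a b c : Ord) : olt b c -> olt (oadd a b) (oadd a c).
Proof. exact (oadd_le_r a (OS b) c). Qed.

Lemma oadd_le_l (a a' b : Ord) : ole a a' -> ole (oadd a b) (oadd a' b).
Proof.
  intros H; induction b as [|b IH|f IH]; simpl; [exact H|exact IH|].
  intros n. apply (ole_sup _ (fun k => oadd a' (f k)) n), IH.
Qed.

Lemma oadd_lt_inv (a b c : Ord) : olt (oadd a b) (oadd a c) -> olt b c.
Proof.
  intros H. apply not_ole_olt. intros H'.
  exact (ole_not_olt _ _ (oadd_le_r a _ _ H') H).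
Qed.

Lemma oadd_le_inv (a b c : Ord) : ole (oadd a b) (oadd a c) -> ole b c.
Proof. exact (oadd_lt_inv a b (OS c)). Qed.

(** Left subtraction of [c] from [x]: descend along [a] until [oadd c a] drops to [x]. *)
Lemma oadd_surj (c x a : Ord) :
  ole c x -> olt x (oadd c a) -> exists y, olt y a /\ oeq x (oadd c y).
Proof.
  intros Hc; induction a as [|a IH|f IH]; intros H.
  - destruct (ole_not_olt _ _ Hc H).
  - destruct (ole_or_olt (oadd c a) x) as [H'|H'].
    + exists a. split; [apply olt_succ_diag|split; [exact H|exact H']].
    + destruct (IH H') as (y & Hy & E). exists y. split; [|exact E].
      apply ole_succ_r, Hy.
  - destruct H as [n Hn]. destruct (IH n Hn) as (y & Hy & E).
    exists y. split; [now exists n|exact E].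
Qed.

Lemma oadd_ofnat (m n : nat) : oadd (ofnat m) (ofnat n) = ofnat (m + n).
Proof.
  induction n as [|n IH]; simpl.
  - now rewrite Nat.add_0_r.
  - now rewrite IH, Nat.add_succ_r.
Qed.

Lemma ofnat_le (m n : nat) : m <= n -> ole (ofnat m) (ofnat n).
Proof.
  intros H; induction H; [apply ole_refl|now apply ole_succ_r].
Qed.

Lemma omega_le_succ (a : Ord) : ole omega (OS a) -> ole omega a.
Proof. intros H n. exact (H (S n)). Qed.

(** At a limit, an infinite term absorbs the 1 by induction, while a term below some finite [k]
    yields at most [1 + k], still below [omega]. *)
Lemma oadd_1_infinite (a : Ord) : ole omega a -> ole (oadd (ofnat 1) a) a.
Proof.
  induction a as [|a IH|f IH]; intros H.
  - destruct (H 1).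
  - apply IH, omega_le_succ, H.
  - intros n. destruct (ole_or_olt omega (f n)) as [Hn|[k Hk]].
    + apply ole_sup with n, IH, Hn.
    + apply ole_trans with (oadd (ofnat 1) (ofnat k)).
      * apply oadd_le_r, olt_ole, Hk.
      * rewrite oadd_ofnat. apply H.
Qed.

(** * Multiplication and powers of omega *)

Lemma omul_ofnat_add (a : Ord) (m n : nat) :
  omul a (ofnat (m + n)) = oadd (omul a (ofnat m)) (omul a (ofnat n)).
Proof.
  induction n as [|n IH]; simpl.
  - now rewrite Nat.add_0_r.
  - now rewrite Nat.add_succ_r, oadd_assoc, <- IH.
Qed.

Lemma omul_le_l (a a' b : Ord) : ole a a' -> ole (omul a b) (omul a' b).
Proof.
  intros H; induction b as [|b IH|f IH]; simpl; [exact I| |].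
  - apply ole_trans with (oadd (omul a b) a').
    + apply oadd_le_r, H.
    + apply oadd_le_l, IH.
  - intros n. apply (ole_sup _ (fun k => omul a' (f k)) n), IH.
Qed.

Lemma omul_le_r (a b c : Ord) : ole b c -> ole (omul a b) (omul a c).
Proof.
  revert c; induction b as [|b IH|f IH]; intros c H; [exact I| |].
  - induction c as [|c _|g IHc]; [destruct H|apply oadd_le_l, IH, H|].
    destruct H as [n Hn].
    apply (ole_sup _ (fun k => omul a (g k)) n), IHc, Hn.
  - intros n. apply IH, H.
Qed.

Lemma omul_ofnat_le (a : Ord) (m n : nat) :
  m <= n -> ole (omul a (ofnat m)) (omul a (ofnat n)).
Proof.
  intros H. apply omul_le_r, ofnat_le, H.
Qed.

Lemma omul_1_r (a : Ord) : omul a (ofnat 1) = a.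
Proof. apply oadd_0_l. Qed.

Lemma omul_1_ofnat (n : nat) : omul (ofnat 1) (ofnat n) = ofnat n.
Proof.
  induction n as [|n IH]; [reflexivity|].
  change (oadd (omul (ofnat 1) (ofnat n)) (ofnat 1) = ofnat (S n)).
  rewrite IH. reflexivity.
Qed.

Lemma oexp_pos (b : Ord) : olt OZ (oexp b).
Proof.
  induction b as [|b IH|f IH].
  - exact I.
  - exists 1. change (ole (OS OZ) (omul (oexp b) (ofnat 1))).
    rewrite omul_1_r. exact IH.
  - exists 0. apply IH.
Qed.

Lemma oexp_le (a b : Ord) : ole a b -> ole (oexp a) (oexp b).
Proof.
  revert b; induction a as [|a IH|f IH]; intros b H.
  - apply oexp_pos.
  - induction b as [|b _|g IHb]; [destruct H| |].
    + apply omul_le_l, IH, H.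
    + destruct H as [n Hn].
      apply (ole_sup _ (fun k => oexp (g k)) n), IHb, Hn.
  - intros n. apply IH, H.
Qed.

Lemma oexp_mul_le (a b : Ord) (k : nat) :
  olt a b -> ole (omul (oexp a) (ofnat k)) (oexp b).
Proof.
  intros H. apply ole_trans with (oexp (OS a)).
  - apply (ole_sup _ (fun n => omul (oexp a) (ofnat n)) k), ole_refl.
  - apply oexp_le, H.
Qed.

Lemma omul_oexp_lt_succ (a : Ord) (k : nat) :
  olt (omul (oexp a) (ofnat k)) (omul (oexp a) (ofnat (S k))).
Proof. exact (oadd_lt_r _ OZ _ (oexp_pos a)). Qed.

Lemma oexp_mul_lt (a b : Ord) (k : nat) :
  olt a b -> olt (omul (oexp a) (ofnat k)) (oexp b).
Proof.
  intros H. eapply olt_ole_trans; [apply omul_oexp_lt_succ|].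
  apply oexp_mul_le, H.
Qed.

(** At a successor, each approximation [omega^b n] of the power only becomes [omega^b (k + n)]. At a
    limit, an exponent [f m] above [a] absorbs by induction, and one at most [a] gives at most
    [omega^a (k + 1)]. *)
Lemma oexp_absorb (a b : Ord) (k : nat) :
  olt a b -> ole (oadd (omul (oexp a) (ofnat k)) (oexp b)) (oexp b).
Proof.
  induction b as [|b _|f IH]; intros H; [destruct H| |].
  - intros n. apply ole_trans with (omul (oexp b) (ofnat (k + n))).
    + rewrite omul_ofnat_add. apply oadd_le_l, omul_le_l, oexp_le, H.
    + apply (ole_sup _ (fun n => omul (oexp b) (ofnat n)) (k + n)), ole_refl.
  - intros m. destruct (ole_or_olt (f m) a) as [Hm|Hm].
    + apply ole_trans with (omul (oexp a) (ofnat (S k))).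
      * apply oadd_le_r, oexp_le, Hm.
      * apply oexp_mul_le, H.
    + apply (ole_sup _ (fun n => oexp (f n)) m), IH, Hm.
Qed.

(** By induction the part after the next term [omega^b' c'] is below [omega^b'], so the whole tail
    is below [omega^b' (c' + 1)], and [b' < b]. *)
Lemma cnf_tail_lt (b : Ord) (c : nat) (l : list (Ord * nat)) :
  cnf_wf ((b, c) :: l) -> olt (cnf_sum l) (oexp b).
Proof.
  revert b c; induction l as [|[b' c'] l IH]; intros b c (_ & H & Hwf).
  - apply oexp_pos.
  - apply olt_ole_trans with (omul (oexp b') (ofnat (S c'))).
    + apply oadd_lt_r, (IH b' c' Hwf).
    + apply oexp_mul_le, H.
Qed.

(** For [b > 0] the power [omega^b] is the supremum of the [omega^b' 2^(k+1)] with [b' < b]; for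
    [b = 0] it is 1, which leaves only [ole x y]. *)
Lemma oadd_oexp_lt_inv (x y b : Ord) :
  olt x (oadd y (oexp b)) ->
  ole x y \/
  exists b' k, olt b' b /\ olt x (oadd y (omul (oexp b') (ofnat (2 ^ S k)))).
Proof.
  induction b as [|b _|f IH]; intros H.
  - now left.
  - right. destruct H as [k Hk]. exists b, k. split; [apply olt_succ_diag|].
    apply olt_ole_trans with (1 := Hk), oadd_le_r, omul_ofnat_le.
    (* [k < 2^(k+1)], so a power of two can replace the multiplier [k]. *)
    pose proof (Nat.pow_gt_lin_r 2 (S k)). lia.
  - destruct H as [n Hn]. destruct (IH n Hn) as [?|(b' & k & Hb & Hx)]; [now left|].
    right. exists b', k. split; [now exists n|exact Hx].
Qed.

(** * The rank values [omega (1 + b) + n] *)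

Definition rank_val (b : Ord) (n : nat) : Ord :=
  oadd (omul omega (oadd (ofnat 1) b)) (ofnat n).

Lemma omega_le_rank_val (b : Ord) : ole omega (rank_val b 0).
Proof.
  rewrite <- (omul_1_r omega) at 1. apply omul_le_r, oadd_ge_l.
Qed.

Lemma rank_val_lt (b b' : Ord) (k : nat) :
  olt b' b -> olt (rank_val b' k) (rank_val b 0).
Proof.
  intros H. apply ole_trans with (omul omega (oadd (ofnat 1) (OS b'))).
  - apply (oadd_le_r _ (ofnat (S k))), (ole_sup _ ofnat (S k)), ole_refl.
  - apply omul_le_r, oadd_le_r, H.
Qed.

(** Counterpart of [oadd_oexp_lt_inv] for ranks: below [omega (1 + b)] lie the naturals, from the
    leading 1, and what is bounded by rank values of smaller exponents. *)
Lemma olt_rank_val_inv (d b : Ord) :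
  olt d (rank_val b 0) ->
  (exists k, ole d (ofnat k)) \/
  exists b' k, olt b' b /\ ole d (rank_val b' k).
Proof.
  unfold rank_val. induction b as [|b _|f IH]; intros H.
  - left. change (olt d (omul omega (ofnat 1))) in H.
    rewrite omul_1_r in H. destruct H as [k Hk].
    exists k. apply olt_ole, Hk.
  - right. destruct H as [k Hk]. exists b, k.
    split; [apply olt_succ_diag|apply olt_ole, Hk].
  - destruct H as [n Hn]. destruct (IH n Hn) as [?|(b' & k & Hb & Hx)]; [now left|].
    right. exists b', k. split; [now exists n|exact Hx].
Qed.

(** * Ranks and gaps of finite suborders *)

(* An interval is given by its end points; [None] is [-oo] on the left and
   [+oo] on the right. *)
Definition above {X : Type} (lt : X -> X -> Prop) (a : option X) (x : X) : Prop :=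
  forall y, a = Some y -> lt y x.

Definition below {X : Type} (lt : X -> X -> Prop) (b : option X) (x : X) : Prop :=
  forall y, b = Some y -> lt x y.

Definition at_most {X : Type} (lt : X -> X -> Prop) (a : option X) (x : X) : Prop :=
  exists y, a = Some y /\ (x = y \/ lt x y).

Definition at_least {X : Type} (lt : X -> X -> Prop) (b : option X) (x : X) : Prop :=
  exists y, b = Some y /\ (x = y \/ lt y x).

(** The cuts of [F] in which a prime extension can place its new point; [a] and [b] are neighbours
    in [F] with both infinities added. *)
Record gap {X : Type} (lt : X -> X -> Prop) (F : list X) (a b : option X) : Prop := {
  gap_left : forall x, a = Some x -> In x F;
  gap_right : forall y, b = Some y -> In y F;
  gap_lt : forall x y, a = Some x -> b = Some y -> lt x y;
  gap_out : forall x, In x F -> at_most lt a x \/ at_least lt b x }.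

Lemma elts_ext {X : Type} (F : list X) (u v : elts X F) :
  proj1_sig u = proj1_sig v -> u = v.
Proof.
  destruct u as [x hx], v as [y hy]; simpl; intros ->.
  f_equal. apply proof_irrelevance.
Qed.

(** Supplies the end points of a cut; [None] occurs when no element satisfies [P], matching its
    reading as an infinite end. *)
Lemma finite_max {X : Type} (lt : X -> X -> Prop) (P : X -> Prop) (l : list X) :
  strict_linear lt ->
  exists a, (forall x, a = Some x -> In x l /\ P x) /\
            (forall x, In x l -> P x -> at_most lt a x).
Proof.
  intros (_ & Htr & Htot). induction l as [|z l (a & Ha & Hmax)].
  - exists None. split; [discriminate|intros x []].
  - destruct (classic (P z /\ ~ at_most lt a z)) as [[Pz Hz]|Hz].
    + exists (Some z). split.
      * intros x [= <-]. simpl. tauto.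
      * intros x [<-|Hx] Px; exists z; split; auto.
        destruct (Hmax x Hx Px) as (y & -> & Hxy).
        destruct (classic (z = y)) as [->|Hne]; [exact Hxy|].
        destruct (Htot z y Hne) as [H|H].
        -- destruct Hz. exists y; auto.
        -- right. destruct Hxy as [->|Hxy]; eauto.
    + exists a. split.
      * intros x Hx. destruct (Ha x Hx). simpl. tauto.
      * intros x [<-|Hx] Px; [|auto].
        apply NNPP. tauto.
Qed.

(** * Gaps under insertion of a point, and prime extensions *)

Lemma strict_linear_flip {X : Type} (lt : X -> X -> Prop) :
  strict_linear lt -> strict_linear (fun x y => lt y x).
Proof.
  intros (Hir & Htr & Htot). split; [|split]; eauto.
Qed.

Lemma gap_flip {X : Type} (lt : X -> X -> Prop) (F : list X) (a b : option X) :
  gap lt F a b -> gap (fun x y => lt y x) F b a.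
Proof.
  intros [Hl Hr Hlt Hout]. split; auto.
  intros x Hx. destruct (Hout x Hx); auto.
Qed.

(** A finite [b] is above [p], hence at or beyond [b']; a finite [b'] is an old point above [p],
    hence at or beyond [b]. Order reversal gives the gap ending at [p]. *)
Lemma gap_cons_left {X : Type} (lt : X -> X -> Prop) (F : list X)
    (a b b' : option X) (p : X) :
  strict_linear lt -> gap lt F a b -> above lt a p -> below lt b p ->
  gap lt (p :: F) (Some p) b' -> b' = b.
Proof.
  intros (Hir & Htr & Htot) [Hl Hr Hlt Hout] Hap Hbp [Hl' Hr' Hlt' Hout'].
  assert (forall w, b = Some w -> exists y, b' = Some y /\ (w = y \/ lt y w)) as Hb.
  { intros w Hw. destruct (Hout' w (or_intror (Hr w Hw))) as [(y & [= <-] & H)|H].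
    - specialize (Hbp w Hw). destruct H as [->|H]; [destruct (Hir _ Hbp)|].
      destruct (Hir p); eauto.
    - exact H. }
  destruct b' as [y|].
  - assert (lt p y) as Hpy by now apply Hlt'.
    assert (In y F) as Hy.
    { destruct (Hr' y eq_refl) as [<-|H]; [destruct (Hir _ Hpy)|exact H]. }
    destruct (Hout y Hy) as [(x & Hx & H)|(w & Hw & H)].
    + specialize (Hap x Hx). destruct (Hir p).
      destruct H as [->|H]; eauto.
    + destruct (Hb w Hw) as (y' & [= <-] & H'). rewrite Hw. f_equal.
      destruct H as [H|H]; [exact H|]. destruct H' as [H'|H']; [now symmetry|].
      destruct (Hir y); eauto.
  - destruct b as [w|]; [|reflexivity].
    destruct (Hb w eq_refl) as (y & [=] & _).
Qed.

Lemma gap_cons {X : Type} (lt : X -> X -> Prop) (F : list X)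
    (a b a' b' : option X) (p : X) :
  strict_linear lt -> gap lt F a b -> above lt a p -> below lt b p ->
  gap lt (p :: F) a' b' ->
  gap lt F a' b' \/ (a' = a /\ b' = Some p) \/ (a' = Some p /\ b' = b).
Proof.
  intros Hlin Hg Hap Hbp Hg'.
  destruct (classic (a' = Some p)) as [->|Ha].
  { right; right. split; [reflexivity|]. eapply gap_cons_left; eauto. }
  destruct (classic (b' = Some p)) as [->|Hb].
  { right; left. split; [|reflexivity].
    eapply (gap_cons_left (fun x y => lt y x)).
    - apply strict_linear_flip, Hlin.
    - apply gap_flip, Hg.
    - exact Hbp.
    - exact Hap.
    - apply gap_flip, Hg'. }
  left. destruct Hg' as [Hl Hr Hlt Hout]. split.
  - intros x Hx. destruct (Hl x Hx) as [<-|H]; [now destruct Ha|exact H].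
  - intros x Hx. destruct (Hr x Hx) as [<-|H]; [now destruct Hb|exact H].
  - exact Hlt.
  - intros x Hx. apply Hout. now right.
Qed.

(** The end points are the largest old point that [R] puts below [None] and the smallest one it puts
    above; transitivity compares [p] with all other old points. *)
Lemma prime_ext_gap {X : Type} (lt : X -> X -> Prop) (F : list X)
    (R : pext X F -> pext X F -> Prop) :
  strict_linear lt -> is_prime_ext X lt F R ->
  exists a b, gap lt F a b /\
    forall p, above lt a p -> below lt b p -> realizes X lt F R (p :: F).
Proof.
  intros Hlin [(Rir & Rtr & Rtot) HR].
  pose proof Hlin as (Hir & Htr & Htot).
  set (lo := fun x => exists h : In x F, R (Some (exist _ x h)) None).
  set (hi := fun x => exists h : In x F, R None (Some (exist _ x h))).
  destruct (finite_max lt lo F Hlin) as (a & Ha & Hamax).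
  destruct (finite_max (fun x y => lt y x) hi F (strict_linear_flip lt Hlin))
    as (b & Hb & Hbmin).
  exists a, b. split.
  - split.
    + intros x Hx. apply Ha, Hx.
    + intros x Hx. apply Hb, Hx.
    + intros x y Hx Hy. destruct (Ha x Hx) as [_ [hx Rx]].
      destruct (Hb y Hy) as [_ [hy Ry]].
      exact (proj1 (HR _ _) (Rtr _ _ _ Rx Ry)).
    + intros x Hx.
      destruct (Rtot (Some (exist _ x Hx)) None) as [H|H]; [discriminate| |].
      * left. apply Hamax; [exact Hx|now exists Hx].
      * right. apply Hbmin; [exact Hx|now exists Hx].
  - intros p Hap Hbp.
    set (f := fun u : pext X F =>
                match u with Some x => proj1_sig x | None => p end).
    assert (forall u v, R u v -> lt (f u) (f v)) as Hf.
    { intros [[x hx]|] [[y hy]|] H; simpl.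
      - exact (proj1 (HR _ _) H).
      - destruct (Hamax x hx) as (z & Hz & Hxz); [now exists hx|].
        specialize (Hap z Hz). destruct Hxz as [->|Hxz]; eauto.
      - destruct (Hbmin y hy) as (z & Hz & Hyz); [now exists hy|].
        specialize (Hbp z Hz). destruct Hyz as [->|Hyz]; eauto.
      - destruct (Rir _ H). }
    split; [intros x Hx; now right|].
    exists f. split; [|split; [|split; [|split]]].
    + intros [[x hx]|]; simpl; auto.
    + intros c [<-|Hc]; [now exists None|now exists (Some (exist _ c Hc))].
    + intros u v E. apply NNPP. intros Hne.
      destruct (Rtot u v Hne) as [H|H]; apply Hf in H; rewrite E in H;
        exact (Hir _ H).
    + intros u v. split; [apply Hf|]. intros H.
      destruct (classic (u = v)) as [->|Hne]; [destruct (Hir _ H)|].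
      destruct (Rtot u v Hne) as [H'|H']; [exact H'|].
      apply Hf in H'. destruct (Hir (f u)); eauto.
    + reflexivity.
Qed.

(** [G] is an invariant for lower bounds. Whatever gap a prime extension selects, its splitting
    point [p] replaces that gap by two good ones, and the other gaps survive by monotonicity. *)
Lemma rk_ge_of_gaps {X : Type} (lt : X -> X -> Prop)
    (G : option X -> option X -> Ord -> Prop) :
  strict_linear lt ->
  (forall a b g d, ole d g -> G a b g -> G a b d) ->
  (forall a b g d, olt d g -> G a b g ->
     exists p, above lt a p /\ below lt b p /\ G a (Some p) d /\ G (Some p) b d) ->
  forall g F, (forall a b, gap lt F a b -> G a b g) -> rk_ge X lt F g.
Proof.
  intros Hlin Hmon Hsplit g.
  induction (olt_wf g) as [g _ IH]. intros F HF.
  destruct (classic (oeq g OZ)) as [Hz|Hz]; [now apply rk_ge_zero|].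
  destruct (classic (exists d, oeq g (OS d))) as [[d Hd]|Hs].
  - assert (olt d g) as Hdg by apply Hd.
    apply rk_ge_succ with d; [exact Hd|].
    intros R HR. destruct (prime_ext_gap lt F R Hlin HR) as (a & b & Hg & Hreal).
    destruct (Hsplit a b g d Hdg (HF a b Hg)) as (p & Hap & Hbp & Gl & Gr).
    exists (p :: F). split; [now apply Hreal|].
    apply IH; [exact Hdg|]. intros a' b' Hg'.
    destruct (gap_cons lt F a b a' b' p Hlin Hg Hap Hbp Hg')
      as [H|[[-> ->]|[-> ->]]]; [|assumption..].
    apply (Hmon a' b' g); [now apply olt_ole|now apply HF].
  - apply rk_ge_lim; [now split|]. intros d Hd. apply IH; [exact Hd|].
    intros a b Hg. apply (Hmon a b g); [now apply olt_ole|now apply HF].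
Qed.

(** Converse of [prime_ext_gap]: [R] puts the new point just after the old points that are at most
    [a], which forces every realization into the gap. *)
Lemma gap_prime_ext {X : Type} (lt : X -> X -> Prop) (F : list X) (a b : option X) :
  strict_linear lt -> gap lt F a b ->
  exists R, is_prime_ext X lt F R /\
    forall C, realizes X lt F R C ->
      exists p, above lt a p /\ below lt b p /\
        gap lt C a (Some p) /\ gap lt C (Some p) b.
Proof.
  intros Hlin [Hl Hr Hlt Hout]. pose proof Hlin as (Hir & Htr & Htot).
  set (R := fun u v : pext X F =>
    match u, v with
    | Some x, Some y => lt (proj1_sig x) (proj1_sig y)
    | Some x, None => at_most lt a (proj1_sig x)
    | None, Some y => ~ at_most lt a (proj1_sig y)
    | None, None => False
    end).
  assert (forall x y, lt x y -> at_most lt a y -> at_most lt a x) as Hdown.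
  { intros x y Hxy (z & Hz & Hyz). exists z. split; [exact Hz|].
    right. destruct Hyz as [->|Hyz]; eauto. }
  exists R. split.
  - split; [|intros; reflexivity]. split; [|split].
    + intros [x|]; simpl; auto.
    + intros [x|] [y|] [z|]; simpl; eauto; try tauto.
      intros Hx Hz. destruct (classic (proj1_sig x = proj1_sig z)) as [E|Hne].
      * rewrite E in Hx. contradiction.
      * destruct (Htot _ _ Hne) as [H|H]; [exact H|]. destruct Hz. eauto.
    + intros [x|] [y|] Hne; simpl.
      * apply Htot. intros E. apply Hne. f_equal. now apply elts_ext.
      * apply classic.
      * destruct (classic (at_most lt a (proj1_sig y))); auto.
      * now destruct Hne.
  - intros C (HFC & f & HfC & Hsurj & _ & Hf & Hid).
    set (p := f None).
    assert (above lt a p) as Hap.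
    { intros x Hx. pose proof (Hf (Some (exist _ x (Hl x Hx))) None) as [H _].
      rewrite Hid in H. apply H. exists x. auto. }
    assert (forall y, In y F -> ~ at_most lt a y -> lt p y) as Hhi.
    { intros y Hy H. pose proof (Hf None (Some (exist _ y Hy))) as [H' _].
      rewrite Hid in H'. apply H', H. }
    assert (below lt b p) as Hbp.
    { intros y Hy. apply Hhi; [now apply Hr|]. intros (x & Hx & H).
      specialize (Hlt x y Hx Hy). destruct (Hir x). destruct H as [<-|H]; eauto. }
    assert (forall c, In c C -> c = p \/ In c F) as HC.
    { intros c Hc. destruct (Hsurj c Hc) as [[x|] <-]; [right|now left].
      rewrite Hid. apply (proj2_sig x). }
    assert (In p C) as HpC by apply HfC.
    exists p. split; [exact Hap|split; [exact Hbp|]]. split; split.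
    + auto.
    + now intros y [= <-].
    + intros x y Hx [= <-]. now apply Hap.
    + intros c Hc. destruct (HC c Hc) as [->|H].
      * right. exists p. auto.
      * destruct (Hout c H) as [H'|(y & Hy & H')]; [now left|right].
        exists p. split; [reflexivity|right]. specialize (Hbp y Hy).
        destruct H' as [->|H']; eauto.
    + now intros y [= <-].
    + auto.
    + intros x y [= <-] Hy. now apply Hbp.
    + intros c Hc. destruct (HC c Hc) as [->|H].
      * left. exists p. auto.
      * destruct (Hout c H) as [(y & Hy & H')|H']; [left|now right].
        exists p. split; [reflexivity|right]. specialize (Hap y Hy).
        destruct H' as [->|H']; eauto.
Qed.

(** A single bad gap bounds the rank: demand a point in it, and one of the two halves is again bad,
    with a smaller bound. *)
Lemma rk_le_of_gap {X : Type} (lt : X -> X -> Prop)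
    (H : option X -> option X -> Ord -> Prop) :
  strict_linear lt ->
  (forall a b g p, H a b g -> above lt a p -> below lt b p ->
     exists d, olt d g /\ (H a (Some p) d \/ H (Some p) b d)) ->
  forall d g F a b, gap lt F a b -> H a b g -> rk_ge X lt F d -> ole d g.
Proof.
  intros Hlin Hsplit d. induction (olt_wf d) as [d _ IH].
  intros g F a b Hg Hab Hrk. destruct Hrk as [F d Hz|F d e He Hrk|F d Hlim Hrk].
  - exact (ole_trans _ OZ _ (proj1 Hz) I).
  - destruct (gap_prime_ext lt F a b Hlin Hg) as (R & HR & Hreal).
    destruct (Hrk R HR) as (C & HC & HCe).
    destruct (Hreal C HC) as (p & Hap & Hbp & Hgl & Hgr).
    destruct (Hsplit a b g p Hab Hap Hbp) as (g' & Hg' & Hor).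
    assert (olt e d) as Hed by apply He.
    apply ole_trans with (OS e); [apply He|]. apply ole_olt_trans with g'; [|exact Hg'].
    destruct Hor as [H'|H'].
    + exact (IH e Hed g' C a (Some p) Hgl H' HCe).
    + exact (IH e Hed g' C (Some p) b Hgr H' HCe).
  (* A limit [d] above [g] is also above [g + 1]; the induction hypothesis at [g + 1] would then
     give [g + 1 <= g]. *)
  - destruct (ole_or_olt d g) as [?|Hgd]; [assumption|].
    destruct (ole_or_olt d (OS g)) as [Hd|Hd].
    + destruct (proj2 Hlim). exists g. now split.
    + destruct (olt_irrefl g). exact (IH _ Hd g F a b Hg Hab (Hrk _ Hd)).
Qed.

(** * The orders Z·alpha *)

(** A chosen tree in the class, since the arithmetic is defined on trees and not on classes. *)
Definition rep {alpha : Ord} (x : OrdBelow alpha) : Ord :=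
  proj1_sig (constructive_indefinite_description _ (proj2_sig x)).

Lemma rep_spec {alpha : Ord} (x : OrdBelow alpha) :
  proj1_sig (proj1_sig x) (rep x) /\ olt (rep x) alpha.
Proof. exact (proj2_sig (constructive_indefinite_description _ (proj2_sig x))). Qed.

Lemma oeq_ext (a b : Ord) : oeq a b -> oeq a = oeq b.
Proof.
  intros [Hab Hba]. apply functional_extensionality. intros c.
  apply propositional_extensionality.
  split; intros [H1 H2]; split; eapply ole_trans; eauto.
Qed.

Lemma Ocls_class (p : Ocls) (a : Ord) : proj1_sig p a -> proj1_sig p = oeq a.
Proof.
  destruct p as [P [b ->]]; simpl. apply oeq_ext.
Qed.

(** Equivalent trees have equal classes by extensionality, and the membership proofs agree by proof
    irrelevance. *)
Lemma rep_inj {alpha : Ord} (x y : OrdBelow alpha) : oeq (rep x) (rep y) -> x = y.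
Proof.
  intros E. pose proof (Ocls_class _ _ (proj1 (rep_spec x))) as Hx.
  pose proof (Ocls_class _ _ (proj1 (rep_spec y))) as Hy.
  rewrite (oeq_ext _ _ E), <- Hy in Hx. clear E Hy.
  destruct x as [[P hP] hx], y as [[Q hQ] hy]; simpl in Hx. subst Q.
  rewrite (proof_irrelevance _ hQ hP) in *. f_equal. apply proof_irrelevance.
Qed.

Lemma rep_surj (alpha a : Ord) :
  olt a alpha -> exists x : OrdBelow alpha, oeq (rep x) a.
Proof.
  intros H.
  assert (oeq a a) as Ha by (split; apply ole_refl).
  set (p := exist (fun P => exists b, P = oeq b) (oeq a) (ex_intro _ a eq_refl) : Ocls).
  set (x := exist (fun q : Ocls => exists b, proj1_sig q b /\ olt b alpha) p
              (ex_intro _ a (conj Ha H)) : OrdBelow alpha).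
  exists x. destruct (proj1 (rep_spec x)). now split.
Qed.

Lemma cls_lt_rep {alpha : Ord} (x y : OrdBelow alpha) :
  cls_lt (proj1_sig x) (proj1_sig y) <-> olt (rep x) (rep y).
Proof.
  pose proof (proj1 (rep_spec x)) as Hx. pose proof (proj1 (rep_spec y)) as Hy.
  split.
  - intros (a & b & Ha & Hb & H).
    rewrite (Ocls_class _ _ Hx) in Ha. rewrite (Ocls_class _ _ Hy) in Hb.
    apply ole_olt_trans with a; [apply Ha|]. apply olt_ole_trans with b; [exact H|apply Hb].
  - intros H. exists (rep x), (rep y). auto.
Qed.

(* The shift by one makes room for [-oo] at position [0]; it turns the count of
   full copies of Z between two end points into a difference of positions. *)
Definition pos {alpha : Ord} (p : ZdotCar alpha) : Ord := oadd (ofnat 1) (rep (fst p)).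

Definition lpos {alpha : Ord} (a : option (ZdotCar alpha)) : Ord :=
  match a with Some p => pos p | None => OZ end.

Definition rpos {alpha : Ord} (b : option (ZdotCar alpha)) : Ord :=
  match b with Some p => pos p | None => oadd (ofnat 1) alpha end.

(** * The order of Z·alpha in terms of positions *)

Lemma pos_lt_top {alpha : Ord} (p : ZdotCar alpha) :
  olt (pos p) (oadd (ofnat 1) alpha).
Proof. apply oadd_lt_r, rep_spec. Qed.

Lemma pos_ge_1 {alpha : Ord} (p : ZdotCar alpha) : ole (ofnat 1) (pos p).
Proof. apply oadd_ge_l. Qed.

Lemma ZdotLt_pos {alpha : Ord} (p q : ZdotCar alpha) :
  ZdotLt alpha p q <->
  olt (pos p) (pos q) \/ (fst p = fst q /\ (snd p < snd q)%Z).
Proof.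
  unfold ZdotLt, pos. rewrite cls_lt_rep.
  split; (intros [H|H]; [left|now right]).
  - now apply oadd_lt_r.
  - now apply oadd_lt_inv in H.
Qed.

Lemma pos_cases {alpha : Ord} (p q : ZdotCar alpha) :
  olt (pos p) (pos q) \/ fst p = fst q \/ olt (pos q) (pos p).
Proof.
  destruct (ole_or_olt (pos p) (pos q)) as [H1|H1]; [|auto].
  destruct (ole_or_olt (pos q) (pos p)) as [H2|H2]; [|auto].
  right; left. apply rep_inj. split; eapply oadd_le_inv; eassumption.
Qed.

Lemma pos_eq {alpha : Ord} (p q : ZdotCar alpha) : fst p = fst q -> pos p = pos q.
Proof. unfold pos. now intros ->. Qed.

Lemma ZdotLt_linear (alpha : Ord) : strict_linear (ZdotLt alpha).
Proof.
  split; [|split].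
  - intros p H. apply ZdotLt_pos in H as [H|[_ H]]; [exact (olt_irrefl _ H)|lia].
  - intros p q r H1 H2. apply ZdotLt_pos in H1, H2. apply ZdotLt_pos.
    destruct H1 as [H1|[E1 H1]], H2 as [H2|[E2 H2]].
    + left. eapply olt_trans; eassumption.
    + left. now rewrite <- (pos_eq _ _ E2).
    + left. now rewrite (pos_eq _ _ E1).
    + right. split; [congruence|lia].
  - intros p q Hne. rewrite !ZdotLt_pos.
    destruct (pos_cases p q) as [H|[E|H]]; [auto| |auto].
    assert (snd p <> snd q) as Hs.
    { intros E'. apply Hne. destruct p, q; simpl in *; congruence. }
    destruct (Z.lt_ge_cases (snd p) (snd q)); [auto|].
    right; right. split; [congruence|lia].
Qed.

Lemma pos_surj (alpha x : Ord) :
  ole (ofnat 1) x -> olt x (oadd (ofnat 1) alpha) ->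
  exists p : ZdotCar alpha, oeq (pos p) x.
Proof.
  intros H1 H2. destruct (oadd_surj _ _ _ H1 H2) as (y & Hy & E).
  destruct (rep_surj alpha y Hy) as [w Hw]. exists (w, 0%Z).
  unfold pos; simpl fst.
  split; [apply ole_trans with (oadd (ofnat 1) y)|apply ole_trans with (oadd (ofnat 1) y)];
    try apply E; apply oadd_le_r, Hw.
Qed.

Lemma rpos_le_top {alpha : Ord} (b : option (ZdotCar alpha)) :
  ole (rpos b) (oadd (ofnat 1) alpha).
Proof.
  destruct b as [p|]; [apply olt_ole, pos_lt_top|apply ole_refl].
Qed.

Lemma above_of_pos {alpha : Ord} (a : option (ZdotCar alpha)) (p : ZdotCar alpha) :
  olt (lpos a) (pos p) -> above (ZdotLt alpha) a p.
Proof. intros H y ->. apply ZdotLt_pos. now left. Qed.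

Lemma below_of_pos {alpha : Ord} (b : option (ZdotCar alpha)) (p : ZdotCar alpha) :
  olt (pos p) (rpos b) -> below (ZdotLt alpha) b p.
Proof. intros H y ->. apply ZdotLt_pos. now left. Qed.

(** * Invariants for the lower and the upper bound *)

Inductive large {alpha : Ord} (a b : option (ZdotCar alpha)) (g : Ord) : Prop :=
| large_block (p q : ZdotCar alpha) (n : nat) :
    a = Some p -> b = Some q -> fst p = fst q ->
    (snd p + Z.of_nat (2 ^ n) <= snd q)%Z -> ole g (ofnat n) -> large a b g
| large_pos (be : Ord) (n : nat) :
    ole (oadd (lpos a) (omul (oexp be) (ofnat (2 ^ n)))) (rpos b) ->
    ole g (rank_val be n) -> large a b g.

(** The strict bound by [2^(n+1)], against [2^n] in [large], is what makes the two invariants meet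
    at a rounded-down logarithm. *)
Inductive small {alpha : Ord} (a b : option (ZdotCar alpha)) (g : Ord) : Prop :=
| small_block (p q : ZdotCar alpha) (n : nat) :
    a = Some p -> b = Some q -> fst p = fst q ->
    (snd q < snd p + Z.of_nat (2 ^ S n))%Z -> ole (ofnat n) g -> small a b g
| small_pos (be : Ord) (n : nat) :
    olt (rpos b) (oadd (lpos a) (omul (oexp be) (ofnat (2 ^ S n)))) ->
    ole (rank_val be n) g -> small a b g.

Lemma pow2_double (n : nat) : 2 ^ S n = 2 ^ n + 2 ^ n.
Proof. simpl. lia. Qed.

Lemma pow2_pos (n : nat) : 1 <= 2 ^ n.
Proof. induction n; simpl; lia. Qed.

Lemma large_pos_interior {alpha : Ord} (a b : option (ZdotCar alpha)) (be : Ord) (n : nat) :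
  olt (oadd (lpos a) (omul (oexp be) (ofnat (2 ^ n)))) (rpos b) ->
  exists p, above (ZdotLt alpha) a p /\ below (ZdotLt alpha) b p /\
    oeq (pos p) (oadd (lpos a) (omul (oexp be) (ofnat (2 ^ n)))).
Proof.
  set (x := oadd _ _). intros Hx.
  assert (olt (lpos a) x) as Hax.
  { apply (oadd_lt_r _ OZ). eapply olt_ole_trans; [apply oexp_pos|].
    rewrite <- (omul_1_r (oexp be)) at 1. apply omul_ofnat_le, pow2_pos. }
  destruct (pos_surj alpha x) as [p Hp].
  - exact (ole_olt_trans OZ _ _ I Hax).
  - eapply olt_ole_trans; [exact Hx|apply rpos_le_top].
  - exists p. split; [|split; [|exact Hp]].
    + apply above_of_pos. eapply olt_ole_trans; [exact Hax|apply Hp].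
    + apply below_of_pos. eapply ole_olt_trans; [apply Hp|exact Hx].
Qed.

(** Halve the power of two while [n > 0]. At [n = 0] the target [d] is below [omega (1 + be)], so
    one side may be much shorter as long as the other keeps its full length. *)
Lemma large_split (alpha : Ord) (a b : option (ZdotCar alpha)) (g d : Ord) :
  olt OZ alpha -> olt d g -> large a b g ->
  exists p, above (ZdotLt alpha) a p /\ below (ZdotLt alpha) b p /\
    large a (Some p) d /\ large (Some p) b d.
Proof.
  intros Halpha Hd [p q n -> -> E Hz Hg|be n Hab Hg];
    pose proof (olt_ole_trans _ _ _ Hd Hg) as Hdn.
  - destruct n as [|n]; [destruct Hdn|].
    rewrite pow2_double in Hz. pose proof (pow2_pos n).
    exists (fst p, (snd p + Z.of_nat (2 ^ n))%Z).
    split; [|split; [|split]].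
    + intros y [= <-]. apply ZdotLt_pos. right. simpl. split; [reflexivity|lia].
    + intros y [= <-]. apply ZdotLt_pos. right. simpl. split; [exact E|lia].
    + eapply large_block; [reflexivity..| |exact Hdn]. simpl. lia.
    + eapply large_block; [reflexivity|reflexivity|exact E| |exact Hdn]. simpl. lia.
  - destruct n as [|n].
    + simpl Nat.pow in Hab. rewrite omul_1_r in Hab.
      destruct (olt_rank_val_inv _ _ Hdn) as [[k Hk]|(be' & k & Hbe & Hk)].
      (* For a finite target, cut off [2^k] integers next to a finite end point. Positions ignore
         the integer coordinate, so the other side keeps its length. *)
      * assert (olt (lpos a) (rpos b)) as Hlt.
        { eapply olt_ole_trans; [|exact Hab]. apply (oadd_lt_r _ OZ), oexp_pos. }
        assert (ole d (rank_val be 0)) as Hdb by apply olt_ole, Hdn.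
        pose proof (pow2_pos k).
        destruct a as [p|]; [|destruct b as [q|]].
        -- exists (fst p, (snd p + Z.of_nat (2 ^ k))%Z).
           split; [|split; [|split]].
           ++ intros y [= <-]. apply ZdotLt_pos. right. simpl. split; [reflexivity|lia].
           ++ now apply below_of_pos.
           ++ eapply large_block; [reflexivity..| |exact Hk]. simpl. lia.
           ++ apply large_pos with be 0; [|exact Hdb].
              simpl Nat.pow. now rewrite omul_1_r.
        -- exists (fst q, (snd q - Z.of_nat (2 ^ k))%Z).
           split; [|split; [|split]].
           ++ now apply above_of_pos.
           ++ intros y [= <-]. apply ZdotLt_pos. right. simpl. split; [reflexivity|lia].
           ++ apply large_pos with be 0; [|exact Hdb].
              simpl Nat.pow. now rewrite omul_1_r.
           ++ eapply large_block; [reflexivity..| |exact Hk]. simpl. lia.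
        (* With both ends infinite any point serves: it is at least one position away from each end,
           which already gives rank [omega]. [Halpha] provides a point. *)
        -- assert (olt (ofnat 1) (oadd (ofnat 1) alpha)) as H1
             by exact (oadd_lt_r _ OZ _ Halpha).
           destruct (pos_surj alpha (ofnat 1) (ole_refl _) H1) as [p Hp].
           assert (ole d (rank_val OZ 0)) as Hd0.
           { apply ole_trans with (1 := Hk). eapply ole_trans; [|apply omega_le_rank_val].
             apply (ole_sup _ ofnat k), ole_refl. }
           exists p. split; [|split; [|split]].
           ++ intros y [=].
           ++ intros y [=].
           ++ apply large_pos with OZ 0; [apply pos_ge_1|exact Hd0].
           ++ apply large_pos with OZ 0; [|exact Hd0].
              simpl Nat.pow. rewrite omul_1_r. apply pos_lt_top.
      (* Split [omega^be' 2^k] positions after [a]; by absorption the right side still has length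
         [omega^be]. *)
      * destruct (large_pos_interior a b be' k) as (p & Hap & Hbp & Hp).
        { eapply olt_ole_trans; [|exact Hab]. apply oadd_lt_r, oexp_mul_lt, Hbe. }
        exists p. split; [exact Hap|split; [exact Hbp|split]].
        -- apply large_pos with be' k; [apply Hp|exact Hk].
        -- apply large_pos with be 0; [|apply olt_ole, Hdn].
           simpl Nat.pow. rewrite omul_1_r. eapply ole_trans; [|exact Hab].
           eapply ole_trans; [apply oadd_le_l, Hp|]. rewrite <- oadd_assoc.
           apply oadd_le_r, oexp_absorb, Hbe.
    + rewrite pow2_double, omul_ofnat_add, oadd_assoc in Hab.
      destruct (large_pos_interior a b be n) as (p & Hap & Hbp & Hp).
      { eapply olt_ole_trans; [|exact Hab]. apply (oadd_lt_r _ OZ).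
        eapply olt_ole_trans; [apply oexp_pos|].
        rewrite <- (omul_1_r (oexp be)) at 1. apply omul_ofnat_le, pow2_pos. }
      exists p. split; [exact Hap|split; [exact Hbp|split]].
      * apply large_pos with be n; [apply Hp|exact Hdn].
      * apply large_pos with be n; [|exact Hdn].
        eapply ole_trans; [apply oadd_le_l, Hp|exact Hab].
Qed.

Lemma lpos_le_pos {alpha : Ord} (a : option (ZdotCar alpha)) (p : ZdotCar alpha) :
  above (ZdotLt alpha) a p -> ole (lpos a) (pos p).
Proof.
  destruct a as [q|]; intros H; [|exact I].
  destruct (proj1 (ZdotLt_pos _ _) (H q eq_refl)) as [H'|[E _]].
  - apply olt_ole, H'.
  - simpl. rewrite (pos_eq _ _ E). apply ole_refl.
Qed.

Lemma pos_le_rpos {alpha : Ord} (b : option (ZdotCar alpha)) (p : ZdotCar alpha) :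
  below (ZdotLt alpha) b p -> ole (pos p) (rpos b).
Proof.
  destruct b as [q|]; intros H; [|apply olt_ole, pos_lt_top].
  destruct (proj1 (ZdotLt_pos _ _) (H q eq_refl)) as [H'|[E _]].
  - apply olt_ole, H'.
  - simpl. rewrite (pos_eq _ _ E). apply ole_refl.
Qed.

(** The passage from [n = 0] to a strictly smaller bound: either both ends lie in one copy of Z and
    the bound is finite, or the length is bounded by a smaller exponent. *)
Lemma small_of_pos_lt {alpha : Ord} (a b : option (ZdotCar alpha)) (be : Ord) :
  ole (lpos a) (rpos b) ->
  olt (rpos b) (oadd (lpos a) (oexp be)) ->
  exists d, olt d (rank_val be 0) /\ small a b d.
Proof.
  intros Hab H.
  destruct (oadd_oexp_lt_inv _ _ _ H) as [Hle|(be' & k & Hbe & Hlt)].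
  - destruct a as [p|]; [destruct b as [q|]|]; simpl in Hle.
    + destruct (pos_cases p q) as [H'|[E|H']].
      * destruct (ole_not_olt _ _ Hle H').
      (* The distance itself is a crude but finite bound, because [n < 2^(n+1)]. *)
      * set (n := Z.to_nat (snd q - snd p)). exists (ofnat n). split.
        -- eapply olt_ole_trans; [|apply omega_le_rank_val].
           exists (S n). apply olt_succ_diag.
        -- eapply small_block; [reflexivity|reflexivity|exact E| |apply ole_refl].
           pose proof (Nat.pow_gt_lin_r 2 (S n)). lia.
      * destruct (ole_not_olt _ _ Hab H').
    + destruct (ole_not_olt _ _ Hle (pos_lt_top p)).
    + destruct (ole_not_olt _ _ Hle). destruct b as [q|].
      * apply pos_ge_1.
      * apply (oadd_ge_l (ofnat 1)).
  - exists (rank_val be' k). split; [apply rank_val_lt, Hbe|].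
    apply small_pos with be' k; [exact Hlt|apply ole_refl].
Qed.

Lemma small_split (alpha : Ord) (a b : option (ZdotCar alpha)) (g : Ord)
    (p : ZdotCar alpha) :
  small a b g -> above (ZdotLt alpha) a p -> below (ZdotLt alpha) b p ->
  exists d, olt d g /\ (small a (Some p) d \/ small (Some p) b d).
Proof.
  intros [x y n -> -> E Hz Hg|be n Hab Hg] Hap Hbp.
  - specialize (Hap x eq_refl). specialize (Hbp y eq_refl).
    apply ZdotLt_pos in Hap, Hbp.
    (* [p] lies between two points of equal position, so it is in their copy of Z. *)
    assert (fst x = fst p /\ (snd x < snd p < snd y)%Z) as [Ep Hp].
    { destruct Hap as [Hap|[E1 H1]], Hbp as [Hbp|[E2 H2]].
      - destruct (olt_irrefl (pos x)). rewrite (pos_eq _ _ E) at 2.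
        eapply olt_trans; eassumption.
      - destruct (olt_irrefl (pos x)). now rewrite (pos_eq x p) at 2 by congruence.
      - destruct (olt_irrefl (pos p)). now rewrite (pos_eq p y) at 2 by congruence.
      - split; [exact E1|lia]. }
    (* For [n = 0] the end points are at distance less than 2 and no integer fits between them. *)
    destruct n as [|n]; [simpl in Hz; lia|].
    rewrite pow2_double in Hz. exists (ofnat n). split; [exact Hg|].
    destruct (Z.lt_ge_cases (snd p) (snd x + Z.of_nat (2 ^ S n))).
    + left. apply small_block with x p n; auto using ole_refl.
    + right. apply small_block with p y n; auto using ole_refl; [congruence|lia].
  - rewrite pow2_double, omul_ofnat_add, oadd_assoc in Hab.
    set (w := omul (oexp be) (ofnat (2 ^ n))) in Hab.
    (* If both sides had length at least [w], the interval would have length at least [w + w],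
       against [Hab]. *)
    assert (olt (pos p) (oadd (lpos a) w) \/ olt (rpos b) (oadd (pos p) w)) as Hor.
    { destruct (ole_or_olt (oadd (lpos a) w) (pos p)) as [H|H]; [right|now left].
      eapply olt_ole_trans; [exact Hab|apply oadd_le_l, H]. }
    destruct n as [|n].
    + subst w. simpl Nat.pow in Hor. rewrite omul_1_r in Hor.
      destruct Hor as [Hor|Hor].
      * destruct (small_of_pos_lt a (Some p) be) as (d & Hd & H);
          [now apply lpos_le_pos|exact Hor|].
        exists d. split; [eapply olt_ole_trans; eassumption|now left].
      * destruct (small_of_pos_lt (Some p) b be) as (d & Hd & H);
          [now apply pos_le_rpos|exact Hor|].
        exists d. split; [eapply olt_ole_trans; eassumption|now right].
    + exists (rank_val be n). split; [exact Hg|].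
      destruct Hor as [Hor|Hor]; [left|right];
        (apply small_pos with be n; [exact Hor|apply ole_refl]).
Qed.

(** * The rank of Z·alpha *)

Lemma gap_nil {X : Type} (lt : X -> X -> Prop) (a b : option X) :
  gap lt [] a b <-> a = None /\ b = None.
Proof.
  split.
  - intros [Hl Hr _ _]. destruct a as [x|]; [destruct (Hl x eq_refl)|].
    destruct b as [y|]; [destruct (Hr y eq_refl)|now split].
  - intros [-> ->]. split; try discriminate. intros x [].
Qed.

(** The empty suborder has the single gap from position 0 to position [1 + alpha]; [small] bounds
    its rank and [large] shows that the bound is attained. *)
Lemma rank_Zdot (alpha be : Ord) (n : nat) :
  olt OZ alpha ->
  ole (omul (oexp be) (ofnat (2 ^ n))) (oadd (ofnat 1) alpha) ->
  olt (oadd (ofnat 1) alpha) (omul (oexp be) (ofnat (2 ^ S n))) ->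
  rank_is (ZdotCar alpha) (ZdotLt alpha) (rank_val be n).
Proof.
  intros Halpha Hlow Hup. split.
  - intros d Hd.
    refine (rk_le_of_gap (ZdotLt alpha) small (ZdotLt_linear alpha)
              (small_split alpha) d _ [] None None _ _ Hd).
    + now apply gap_nil.
    + apply small_pos with be n; [|apply ole_refl].
      simpl lpos. now rewrite oadd_0_l.
  - intros e He. apply He.
    apply (rk_ge_of_gaps (ZdotLt alpha) large (ZdotLt_linear alpha)).
    + intros a b g d Hd [p q k Ha Hb E Hz Hg|be' k Hab Hg];
        pose proof (ole_trans _ _ _ Hd Hg).
      * eapply large_block; eassumption.
      * eapply large_pos; eassumption.
    + intros a b g d. apply large_split, Halpha.
    + intros a b [-> ->]%gap_nil. apply large_pos with be n; [|apply ole_refl].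
      simpl lpos. now rewrite oadd_0_l.
Qed.

Theorem theorem6p20 :
  (forall m : nat, (1 <= m)%nat ->
     rank_is (ZdotCar (ofnat m)) (@ZdotLt (ofnat m))
       (oadd omega (ofnat (Nat.log2 (m + 1))))) /\
  (forall (alpha beta1 : Ord) (c1 : nat) (rest : list (Ord * nat)),
     ole omega alpha ->
     is_CNF alpha ((beta1, c1) :: rest) ->
     rank_is (ZdotCar alpha) (@ZdotLt alpha)
       (oadd (omul omega (oadd (ofnat 1) beta1)) (ofnat (Nat.log2 c1)))).
Proof.
  split.
  - intros m Hm.
    destruct (Nat.log2_spec (m + 1)) as [H1 H2]; [lia|].
    (* Exhibits [omega] as [omega (1 + 0)], the case [be = 0], where lengths are the naturals and
       the total length is [1 + m]. *)
    rewrite <- (omul_1_r omega).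
    apply (rank_Zdot _ OZ); simpl oexp.
    + exact (ofnat_le 1 m Hm).
    + change (OS OZ) with (ofnat 1). rewrite omul_1_ofnat, oadd_ofnat.
      apply ofnat_le. lia.
    + change (OS OZ) with (ofnat 1). rewrite omul_1_ofnat, oadd_ofnat.
      apply (ofnat_le (S (1 + m))). lia.
  - intros alpha be c rest Hom [Hwf [Ha1 Ha2]].
    destruct (Nat.log2_spec c) as [H1 H2]; [apply Hwf|].
    apply rank_Zdot.
    + exact (Hom 1).
    + apply ole_trans with alpha.
      * eapply ole_trans; [|exact Ha2]. eapply ole_trans; [|apply oadd_ge_l].
        apply omul_ofnat_le, H1.
      * rewrite <- (oadd_0_l alpha) at 1. apply oadd_le_l. exact I.
    (* [1 + alpha <= alpha < omega^be (c + 1) <= omega^be 2^(log2 c + 1)], the strict step because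
       the tail is below [omega^be]. *)
    + eapply ole_olt_trans; [apply oadd_1_infinite, Hom|].
      eapply ole_olt_trans; [exact Ha1|].
      apply olt_ole_trans with (omul (oexp be) (ofnat (S c))).
      * exact (oadd_lt_r _ _ _ (cnf_tail_lt _ _ _ Hwf)).
      * apply omul_ofnat_le, H2.
Qed.
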